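(* Let $\mathcal D$ be a convexity condition. The Banach lattice $\mathrm{FBL}^{\mathcal D}[\ell_1]$ is projectively universal for the class of separable, $\mathcal D$-convex Banach lattices.
   Context: All vector spaces, Banach spaces and Banach lattices are real; ''operator'' means bounded linear operator, ''lattice homomorphism'' means linear lattice homomorphism. For $m\in\mathbb N$, $\mathcal H_m$ denotes the vector lattice of continuous, positively homogeneous functions $\mathbb R^m\to\mathbb R$. For a Banach lattice $X$, $h\in\mathcal H_m$ and $x_1,\dots,x_m\in X$, the element $h(x_1,\dots,x_m)\in X$ is defined by the positively homogeneous continuous function calculus: it is $\Phi(h)$, where $\Phi\colon\mathcal H_m\to X$ is the unique lattice homomorphism sending the $k$-th coordinate projection to $x_k$ for each $k$. A function $h\in\mathcal H_m$ is monotone on $\mathbb R^m_+$ if $h(t_1,\dots,t_m)\le h(s_1,\dots,s_m)$ whenever $0\le t_k\le s_k$ for all $k$; $\mathcal H_m^{>0}$ is the set of $h\in\mathcal H_m$ that are monotone on $\mathbb R^m_+$. A convexity condition is a triple $\mathcal D=(\mathcal G,M,\vartheta)$, where $\mathcal G$ is a nonempty subset of $\bigcup_{m=1}^\infty\mathcal H_m^{>0}$ and $M\colon\mathcal G\to[1,\infty)$ and $\vartheta\colon\mathcal G\to\{0,1\}$ are arbitrary functions. A Banach lattice $X$ is $\mathcal D$-convex if, for every $m\in\mathbb N$ and $g\in\mathcal G\cap\mathcal H_m^{>0}$, the inequality $\|g(x_1,\dots,x_m)\|\le M(g)\cdot g(\|x_1\|,\dots,\|x_m\|)$ holds for all pairwise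 disjoint $x_1,\dots,x_m\in X_+$ if $\vartheta(g)=0$, and for all $x_1,\dots,x_m\in X_+$ if $\vartheta(g)=1$. For a Banach space $E$, the free $\mathcal D$-convex Banach lattice over $E$ is the pair $(\mathrm{FBL}^{\mathcal D}[E],\phi_E^{\mathcal D})$ (it exists and is unique up to isometric lattice isomorphism compatible with the embeddings of $E$) consisting of a $\mathcal D$-convex Banach lattice $\mathrm{FBL}^{\mathcal D}[E]$ and a linear isometry $\phi_E^{\mathcal D}\colon E\to\mathrm{FBL}^{\mathcal D}[E]$ such that for every $\mathcal D$-convex Banach lattice $X$ and every operator $T\colon E\to X$ there is a unique lattice homomorphism $\widehat T\colon\mathrm{FBL}^{\mathcal D}[E]\to X$ with $\widehat T\circ\phi_E^{\mathcal D}=T$, and moreover $\|\widehat T\|=\|T\|$. A Banach lattice $Z$ is projectively universal for the class of separable, $\mathcal D$-convex Banach lattices if $Z$ is separable and $\mathcal D$-convex, and every separable, $\mathcal D$-convex Banach lattice $X$ is lattice isometric to a quotient of $Z$ (by a closed ideal); equivalently, for every such $X$ there is a lattice homomorphism from $Z$ onto $X$ which maps the open unit ball of $Z$ onto the open unit ball of $X$. *)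

(* Defs.v *)
From HB Require Import structures.
From mathcomp Require Import all_boot all_order all_algebra.
From mathcomp Require Import all_classical all_reals all_analysis.

Set Implicit Arguments.
Unset Strict Implicit.
Unset Printing Implicit Defensive.

Import Order.TTheory GRing.Theory Num.Theory.
Import numFieldNormedType.Exports.

Local Open Scope classical_set_scope.
Local Open Scope ring_scope.

(** * Vector lattices and Banach lattices *)

Reserved Notation "x <=v y" (at level 70, y at next level).

(* The order is not taken from the [Order] hierarchy: its structures cannot be
   joined with those of modules and normed modules, since [numDomainType]
   inherits from both without a join having been declared. *)
HB.mixin Record Lmodule_isVectorLattice (R : realType) V
    of GRing.Lmodule R V := {
  vle : V -> V -> Prop;
  vjoin : V -> V -> V;
  vmeet : V -> V -> V;
  vle_refl : forall x : V, vle x x;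
  vle_anti : forall x y : V, vle x y -> vle y x -> x = y;
  vle_trans : forall y x z : V, vle x y -> vle y z -> vle x z;
  vleD2r : forall z x y : V, vle x y -> vle (x + z) (y + z);
  vscale_ge0 : forall (a : R) (x : V), 0 <= a -> vle 0 x -> vle 0 (a *: x);
  vle_joinl : forall x y : V, vle x (vjoin x y);
  vle_joinr : forall x y : V, vle y (vjoin x y);
  vjoin_le : forall x y z : V, vle x z -> vle y z -> vle (vjoin x y) z;
  vmeet_lel : forall x y : V, vle (vmeet x y) x;
  vmeet_ler : forall x y : V, vle (vmeet x y) y;
  vle_meet : forall x y z : V, vle z x -> vle z y -> vle z (vmeet x y)
}.

#[short(type="vectorLatticeType")]
HB.structure Definition VectorLattice (R : realType) :=
  { V of Lmodule_isVectorLattice R V & GRing.Lmodule R V }.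

Notation "x <=v y" := (vle x y) : ring_scope.

Definition vabs (R : realType) (V : vectorLatticeType R) (x : V) : V :=
  vjoin x (- x).

Definition vdisjoint (R : realType) (V : vectorLatticeType R) (x y : V) : Prop :=
  vmeet (vabs x) (vabs y) = 0.

HB.mixin Record Normed_VectorLattice_isBanachLattice (R : realType) V
    of CompleteNormedModule R V & VectorLattice R V := {
  ler_norm_vabs : forall x y : V, vabs x <=v vabs y -> `|x| <= `|y|
}.

#[short(type="banachLatticeType")]
HB.structure Definition BanachLattice (R : realType) :=
  { V of Normed_VectorLattice_isBanachLattice R V
       & CompleteNormedModule R V & VectorLattice R V }.

Definition lattice_hom (R : realType) (V W : vectorLatticeType R)
    (f : V -> W) : Prop :=
  [/\ linear f, {morph f : x y / vjoin x y} & {morph f : x y / vmeet x y}].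

(* Valued in [\bar R]: an unbounded map has norm [+oo]. *)
Definition opnorm (R : realType) (E F : normedModType R) (f : E -> F) : \bar R :=
  ereal_sup [set (`|f x|)%:E | x in [set x : E | `|x| <= 1]].

Definition bounded_operator (R : realType) (E F : normedModType R)
    (f : E -> F) : Prop :=
  linear f /\ (opnorm f < +oo)%E.

Definition separable (T : topologicalType) : Prop :=
  exists2 A : set T, countable A & dense A.

(** * Quotients of Banach lattices by closed ideals *)

Definition closed_ideal (R : realType) (Z : banachLatticeType R)
    (J : set Z) : Prop :=
  [/\ closed J, J 0, forall (a : R) (x y : Z), J x -> J y -> J (a *: x + y)
    & forall x y : Z, vabs x <=v vabs y -> J y -> J x].

(* [p : Z -> Q] exhibits [Q] as the quotient Banach lattice [Z / J]; the last
   condition says that [Q] carries the quotient norm. *)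
Definition is_quotient (R : realType) (Z : banachLatticeType R) (J : set Z)
    (Q : banachLatticeType R) (p : Z -> Q) : Prop :=
  [/\ lattice_hom p, set_surj [set: Z] [set: Q] p, p @^-1` [set 0] = J
    & forall z : Z, `|p z| = inf [set `|z + j| | j in J]].

Definition lattice_isometric (R : realType) (X Y : banachLatticeType R) : Prop :=
  exists u : X -> Y, [/\ lattice_hom u, set_surj [set: X] [set: Y] u
    & forall x : X, `|u x| = `|x|].

(** * Continuous positively homogeneous functions *)

Definition poshom_pred (R : realType) (m : nat) : {pred 'rV[R]_m -> R} :=
  fun h => `[< continuous h /\
    forall (a : R) (t : 'rV[R]_m), 0 <= a -> h (a *: t) = a * h t >].
Arguments poshom_pred : clear implicits.

Record poshom (R : realType) (m : nat) := PosHom {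
  poshom_fun :> 'rV[R]_m -> R;
  poshomP : poshom_fun \in poshom_pred R m }.

HB.instance Definition _ R m := [isSub for @poshom_fun R m].
HB.instance Definition _ R m := [Choice of poshom R m by <:].

Section poshom_closed.
Context (R : realType) (m : nat).

Implicit Types f g : 'rV[R]_m -> R.

Lemma poshom_linear_closed (a : R) f g :
  f \in poshom_pred R m -> g \in poshom_pred R m ->
  (fun t => a * f t + g t) \in poshom_pred R m.
Proof.
move=> /asboolP[fc fh] /asboolP[gc gh]; apply/asboolP; split.
- move=> t; have FF : Filter (nbhs t) := nbhs_filter (t : 'rV[R]_m).
  apply: (@cvgD _ _ _ _ _ (fun s => a * f s) g (a * f t)); last exact: gc.
  exact: (cvgMl_tmp (fc t)).
- by move=> b t b0; rewrite fh// gh// mulrCA -mulrDr.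
Qed.

Lemma poshom_submod_closed : submod_closed (poshom_pred R m).
Proof.
split=> [|a f g]; last exact: poshom_linear_closed.
apply/asboolP; split; first exact: (@cst_continuous _ _ (0 : R)).
by move=> a t _; rewrite mulr0.
Qed.

Lemma poshom_min_closed f g :
  f \in poshom_pred R m -> g \in poshom_pred R m ->
  (fun t => Num.min (f t) (g t)) \in poshom_pred R m.
Proof.
move=> /asboolP[fc fh] /asboolP[gc gh]; apply/asboolP; split.
- by move=> t; apply: continuous_min; [exact: fc|exact: gc].
- by move=> a t a0; rewrite fh// gh// minr_pMr.
Qed.

Lemma poshom_max_closed f g :
  f \in poshom_pred R m -> g \in poshom_pred R m ->
  (fun t => Num.max (f t) (g t)) \in poshom_pred R m.
Proof.
move=> /asboolP[fc fh] /asboolP[gc gh]; apply/asboolP; split.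
- by move=> t; apply: continuous_max; [exact: fc|exact: gc].
- by move=> a t a0; rewrite fh// gh// maxr_pMr.
Qed.

End poshom_closed.

HB.instance Definition _ (R : realType) m :=
  GRing.isSubmodClosed.Build R _ (poshom_pred R m) (@poshom_submod_closed R m).
HB.instance Definition _ (R : realType) m := [SubChoice_isSubLmodule of poshom R m by <:].

Section poshom_vectorLattice.
Context (R : realType) (m : nat).
Implicit Types f g h : poshom R m.

Definition poshom_le f g : Prop := forall t, f t <= g t.
Definition poshom_min f g : poshom R m :=
  PosHom (poshom_min_closed (poshomP f) (poshomP g)).
Definition poshom_max f g : poshom R m :=
  PosHom (poshom_max_closed (poshomP f) (poshomP g)).

Let le_refl f : poshom_le f f. Proof. by move=> t. Qed.

Let le_anti f g : poshom_le f g -> poshom_le g f -> f = g.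
Proof.
move=> fg gf; apply/val_inj/funext => t.
by apply/eqP; rewrite eq_le; apply/andP; split; [exact: fg|exact: gf].
Qed.

Let le_trans g f h : poshom_le f g -> poshom_le g h -> poshom_le f h.
Proof. by move=> fg gh t; exact: le_trans (fg t) (gh t). Qed.

Let leD2r h f g : poshom_le f g -> poshom_le (f + h) (g + h).
Proof. by move=> fg t; exact: lerD (fg t) (lexx (h t)). Qed.

Let scale_ge0 (a : R) f : 0 <= a -> poshom_le 0 f -> poshom_le 0 (a *: f).
Proof. by move=> a0 f0 t; apply: mulr_ge0 => //; exact: f0. Qed.

Let le_maxl f g : poshom_le f (poshom_max f g).
Proof. by move=> t /=; rewrite le_max lexx. Qed.

Let le_maxr f g : poshom_le g (poshom_max f g).
Proof. by move=> t /=; rewrite le_max lexx orbT. Qed.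

Let max_le f g h : poshom_le f h -> poshom_le g h -> poshom_le (poshom_max f g) h.
Proof. by move=> fh gh t /=; rewrite ge_max fh gh. Qed.

Let min_lel f g : poshom_le (poshom_min f g) f.
Proof. by move=> t /=; rewrite ge_min lexx. Qed.

Let min_ler f g : poshom_le (poshom_min f g) g.
Proof. by move=> t /=; rewrite ge_min lexx orbT. Qed.

Let le_min f g h : poshom_le h f -> poshom_le h g -> poshom_le h (poshom_min f g).
Proof. by move=> hf hg t /=; rewrite le_min hf hg. Qed.

HB.instance Definition _ := Lmodule_isVectorLattice.Build R (poshom R m)
  le_refl le_anti le_trans leD2r scale_ge0
  le_maxl le_maxr max_le min_lel min_ler le_min.

Lemma coord_poshom_subproof (k : 'I_m) :
  (fun t : 'rV[R]_m => t ord0 k) \in poshom_pred R m.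
Proof.
apply/asboolP; split; last by move=> a t _; rewrite mxE.
exact: coord_continuous.
Qed.

Definition coord_poshom (k : 'I_m) : poshom R m :=
  PosHom (coord_poshom_subproof k).

End poshom_vectorLattice.

(* [Phi] is the function calculus at [x_1, ..., x_m], i.e. [h(x_1, ..., x_m)]
   is [Phi h].  On a Banach lattice such a [Phi] exists and is unique. *)
Definition function_calculus (R : realType) (X : banachLatticeType R) (m : nat)
    (x : 'I_m -> X) (Phi : poshom R m -> X) : Prop :=
  lattice_hom Phi /\ forall k : 'I_m, Phi (coord_poshom R k) = x k.

Definition monotone_nneg (R : realType) (m : nat) (h : poshom R m) : Prop :=
  forall t s : 'rV[R]_m,
    (forall k : 'I_m, 0 <= t ord0 k <= s ord0 k) -> h t <= h s.

(** * Convexity conditions *)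

(* Functions of [m >= 1] variables are indexed by [m.-1]. The values of
   [cc_const] and [cc_all] outside of [cc_fun] are irrelevant; [cc_all g] is
   the truth value of [theta(g) = 1]. *)
Record convexity_condition (R : realType) := ConvexityCondition {
  cc_fun : forall m : nat, set (poshom R m.+1);
  cc_fun_neq0 : exists m : nat, @cc_fun m !=set0;
  cc_fun_monotone : forall (m : nat) (g : poshom R m.+1),
    @cc_fun m g -> monotone_nneg g;
  cc_const : forall m : nat, poshom R m.+1 -> R;
  cc_const_ge1 : forall (m : nat) (g : poshom R m.+1),
    @cc_fun m g -> 1 <= cc_const g;
  cc_all : forall m : nat, poshom R m.+1 -> bool }.
Arguments cc_fun {R} D m : rename.
Arguments cc_const {R} D {m} g : rename.
Arguments cc_all {R} D {m} g : rename.

Definition D_convex (R : realType) (D : convexity_condition R)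
    (X : banachLatticeType R) : Prop :=
  forall (m : nat) (g : poshom R m.+1), cc_fun D m g ->
  forall x : 'I_m.+1 -> X, (forall i, 0 <=v x i) ->
    (~~ cc_all D g -> forall i j, i != j -> vdisjoint (x i) (x j)) ->
  forall Phi : poshom R m.+1 -> X, function_calculus x Phi ->
    `|Phi g| <= cc_const D g * g (\row_i `|x i|).

Definition is_free_D_convex (R : realType) (D : convexity_condition R)
    (E : completeNormedModType R) (F : banachLatticeType R) (phi : E -> F) : Prop :=
  [/\ D_convex D F, linear phi, forall x : E, `|phi x| = `|x|
    & forall X : banachLatticeType R, D_convex D X ->
      forall T : E -> X, bounded_operator T ->
      exists That : F -> X,
        unique (fun S : F -> X => lattice_hom S /\ S \o phi = T) That /\
        opnorm That = opnorm T].

Definition projectively_universal (R : realType) (D : convexity_condition R)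
    (Z : banachLatticeType R) : Prop :=
  [/\ separable Z, D_convex D Z
    & forall X : banachLatticeType R, separable X -> D_convex D X ->
      exists (J : set Z) (Q : banachLatticeType R) (p : Z -> Q),
        [/\ closed_ideal J, is_quotient J p & lattice_isometric X Q]].

(** * The Banach space of absolutely summable sequences *)

Definition ell1_pred (R : realType) : {pred nat -> R} :=
  fun x => `[< summable [set: nat] (EFin \o x) >].
Arguments ell1_pred : clear implicits.

Record ell1 (R : realType) := Ell1 {
  ell1_seq :> nat -> R;
  ell1P : ell1_seq \in ell1_pred R }.

HB.instance Definition _ R := [isSub for @ell1_seq R].
HB.instance Definition _ R := [Choice of ell1 R by <:].

Section ell1_normed.
Context (R : realType).

Definition esum_norm (x : nat -> R) : \bar R :=
  \esum_(n in [set: nat]) `|(x n)%:E|%E.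

Lemma esum_norm_ge0 x : (0 <= esum_norm x)%E.
Proof. exact: esum_ge0. Qed.

Lemma esum_normD x y :
  (esum_norm (fun n => (x n + y n)%R) <= esum_norm x + esum_norm y)%E.
Proof.
rewrite /esum_norm -esumD//; apply: le_esum => n _.
by rewrite EFinD; exact: lee_abs_add.
Qed.

Lemma esum_normZ_le (a : R) x :
  (esum_norm (fun n => (a * x n)%R) <= `|a|%:E * esum_norm x)%E.
Proof.
apply: ge_ereal_sup => _ [A fA <-].
under eq_fsbigr do rewrite EFinM abseM.
rewrite -ge0_mule_fsumr//; apply: lee_wpmul2l; first by rewrite lee_fin.
by apply: esum_ge; exists A.
Qed.

Lemma ell1_predP x : reflect (esum_norm x < +oo)%E (x \in ell1_pred R).
Proof. exact: asboolP. Qed.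

Lemma ell1_submod_closed : submod_closed (ell1_pred R).
Proof.
split=> [|a x y /ell1_predP xoo /ell1_predP yoo]; apply/ell1_predP.
  by rewrite /esum_norm esum1// => n _; rewrite abse0.
apply: le_lt_trans (esum_normD (fun n => a * x n)%R y) _.
apply: lte_add_pinfty => //; apply: le_lt_trans (esum_normZ_le a x) _.
by apply: lte_mul_pinfty.
Qed.

HB.instance Definition _ :=
  GRing.isSubmodClosed.Build R _ (ell1_pred R) ell1_submod_closed.
HB.instance Definition _ := [SubChoice_isSubLmodule of ell1 R by <:].

Implicit Types x y : ell1 R.

Definition ell1_norm x : R := fine (esum_norm x).

Lemma ell1_normE x : ((ell1_norm x)%:E = esum_norm x)%E.
Proof.
rewrite fineK// ge0_fin_numE ?esum_norm_ge0//; exact/ell1_predP/ell1P.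
Qed.

Lemma ell1_normD x y : ell1_norm (x + y) <= ell1_norm x + ell1_norm y.
Proof. by rewrite -lee_fin EFinD !ell1_normE; exact: esum_normD. Qed.

Lemma ell1_normZ (a : R) x : ell1_norm (a *: x) = `|a| * ell1_norm x.
Proof.
have le b z : ell1_norm (b *: z) <= `|b| * ell1_norm z.
  by rewrite -lee_fin EFinM !ell1_normE; exact: esum_normZ_le.
apply/eqP; rewrite eq_le le/=.
have [->|a0] := eqVneq a 0.
  by rewrite normr0 mul0r -lee_fin ell1_normE esum_norm_ge0.
have := le a^-1 (a *: x); rewrite scalerA mulVf// scale1r normfV.
by rewrite mulrC ler_pdivlMr ?normr_gt0// mulrC.
Qed.

Lemma ell1_norm_ge x n : `|x n| <= ell1_norm x.
Proof.
rewrite -lee_fin ell1_normE; apply: esum_ge; exists [set n] => //.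
by rewrite fsbig_set1.
Qed.

Lemma ell1_norm_eq0 x : ell1_norm x = 0 -> x = 0.
Proof.
move=> x0; apply/val_inj/funext => n; apply/eqP.
by rewrite -normr_le0 -x0 ell1_norm_ge.
Qed.

HB.instance Definition _ :=
  Lmodule_isNormed.Build R (ell1 R) ell1_normD ell1_normZ ell1_norm_eq0.

Lemma ell1_coord_cvg (F : set_system (ell1 R)) n :
  ProperFilter F -> cauchy F -> cvg ((fun x : ell1 R => x n) @ F).
Proof.
move=> PF /cauchyP cF; apply: cauchy_cvg.
apply: (@cauchy_exP R R) => e e0; have [x Fx] := cF _ e0.
exists (x n); apply: (@filterS _ F _ _ _ _ Fx) => y.
rewrite -!ball_normE/= => xy.
by apply: le_lt_trans xy; exact: (ell1_norm_ge (x - y)).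
Qed.

Lemma ell1_cauchy_cvg (F : set_system (ell1 R)) :
  ProperFilter F -> cauchy F -> cvg F.
Proof.
move=> PF cF.
pose l n : R := lim ((fun x : ell1 R => x n) @ F).
have near_l e : 0 < e ->
    F [set x : ell1 R | (esum_norm (fun n => (x n - l n)%R) <= e%:E)%E].
  move=> e0; have e20 : 0 < e / 2 by rewrite divr_gt0.
  have /cauchyP/(_ _ e20)[x0 Fx0] := cF.
  apply: (@filterS _ F _ _ _ _ Fx0) => x x0x.
  apply: ge_ereal_sup => _ [A [fA _] <-].
  rewrite fsbig_finite// /= sumEFin lee_fin.
  pose s (z : nat -> R) : R :=
    \sum_(n <- finmap.enum_fset (fset_set A)) `|x n - z n|.
  have cvgs : (fun y : ell1 R => s y) @ F --> s l.
    apply: cvg_big => [|n _].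
      exact: add_continuous.
    apply: cvg_norm; apply: cvgB; first exact: cvg_cst.
    exact: ell1_coord_cvg.
  apply: (cvgr_to_le cvgs); apply: (@filterS _ F _ _ _ _ Fx0) => y x0y.
  have xy : ell1_norm (x - y) <= e.
    apply: ltW; rewrite -[ell1_norm _]/(`|x - y|).
    move: x0x x0y; rewrite -ball_normE/= => x0x x0y.
    rewrite (splitr e) -[x - y](subrKA x0).
    by rewrite (le_lt_trans (ler_normD _ _))// ltrD// distrC.
  apply: le_trans xy; rewrite -lee_fin ell1_normE; apply: esum_ge.
  by exists A; [split|rewrite fsbig_finite//= sumEFin].
have lP : l \in ell1_pred R.
  have /filter_ex[x xl] := near_l 1 ltr01.
  have xlP : (fun n => x n - l n) \in ell1_pred R.
    by apply/ell1_predP; apply: le_lt_trans xl _; rewrite ltry.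
  rewrite (_ : l = (fun n => -1 * (x n - l n) + x n)); last first.
    by apply/funext => n; rewrite mulN1r opprB subrK.
  exact: (ell1_submod_closed.2 (-1) _ _ xlP (ell1P x)).
apply/cvg_ex; exists (Ell1 lP); apply/cvgrPdist_le => e e0.
have := near_l e e0; apply: filterS => x xl.
by rewrite distrC -lee_fin [leLHS]ell1_normE.
Qed.

HB.instance Definition _ := Uniform_isComplete.Build (ell1 R) ell1_cauchy_cvg.

End ell1_normed.

(* Main.v *)
Require Import Defs.
From HB Require Import structures.
From mathcomp Require Import all_boot all_order all_algebra.
From mathcomp Require Import all_classical all_reals all_analysis.
From mathcomp Require Import lra.

(** Write [e_n] for the unit vectors of [ell1] and [F] for the free space.

    Quotients. Let [X] be separable and [D]-convex, and let [x_n] be dense in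
    its unit ball. The operator [T : ell1 -> X] with [T e_n = x_n] is a
    contraction, and a vector [u] with [|u| < r] is as close as desired to some
    [T (r e_n)], where [r e_n] has norm [r]. Successive approximation in the
    complete space [ell1] removes the error ([approx_surj], [ell1_op_surj]):
    such a [u] is [T y] for some [y] with [|y| <= r]. The lattice homomorphism
    [p : F -> X] that extends [T] has the norm of [T], so it is a contraction as
    well, and it inherits this lifting property because [phi] is isometric. A
    contractive lattice homomorphism with the lifting property is the quotient
    map by its kernel ([quotient_by_kernel]); hence [X] itself is the quotient.

    Separability. The universal property forces [F] to be generated by the
    image of [phi] ([free_sublattice_full]): if a closed sublattice [S]
    contains that image, then [S] is again a [D]-convex Banach lattice
    ([D_convex_sublattice]), so [phi], seen as a map into [S], extends to
    [U : F -> S]; the composite of [U] with the inclusion of [S] is an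
    endomorphism of [F] that extends [phi], as the identity does, so they are
    equal and [S] is all of [F]. This is applied to the closed sublattice
    generated by the vectors [phi e_n]. It contains the image of [phi], because
    finitely supported sequences are dense in [ell1], and it is separable,
    because the closure of the [phi e_n] under joins and rational combinations
    is countable. *)

Set Implicit Arguments.
Unset Strict Implicit.
Unset Printing Implicit Defensive.

Import Order.TTheory GRing.Theory Num.Theory.
Import numFieldNormedType.Exports.

Local Open Scope classical_set_scope.
Local Open Scope ring_scope.

(** * Linear maps and contractions *)

Section linear_function.
Context (R : pzRingType) (U V : lmodType R) (f : U -> V) (fl : linear f).

Lemma linear_fun0 : f 0 = 0.
Proof. by have := fl (-1) 0 0; rewrite scaler0 addr0 scaleN1r addNr. Qed.

Lemma linear_funZ a x : f (a *: x) = a *: f x.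
Proof. by have := fl a x 0; rewrite linear_fun0 !addr0. Qed.

Lemma linear_funD x y : f (x + y) = f x + f y.
Proof. by have := fl 1 x y; rewrite !scale1r. Qed.

Lemma linear_funB x y : f (x - y) = f x - f y.
Proof. by rewrite -scaleN1r linear_funD linear_funZ scaleN1r. Qed.

End linear_function.

Section operators.
Context (R : realType) (E F : normedModType R) (f : E -> F).

Lemma opnorm_le1 : linear f ->
  (opnorm f <= 1)%E <-> (forall x, `|f x| <= `|x|).
Proof.
move=> fl; split=> [f1 x|f1]; last first.
  by apply: ge_ereal_sup => _ [x /= x1 <-]; rewrite lee_fin (le_trans (f1 x)).
have [->|x0] := eqVneq x 0; first by rewrite (linear_fun0 fl) !normr0.
have nx : 0 < `|x| by rewrite normr_gt0.
have : (`|f (`|x|^-1 *: x)|%:E <= 1)%E.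
  apply: le_trans f1; apply: ereal_sup_ubound; exists (`|x|^-1 *: x) => //=.
  by rewrite normrZ normfV normr_id mulVf// gt_eqF.
rewrite lee_fin (linear_funZ fl) normrZ normfV normr_id mulrC.
by rewrite ler_pdivrMr// mul1r.
Qed.

End operators.

Lemma contraction_cvg (R : realType) (E F : normedModType R) (f : E -> F)
    (T : Type) (G : set_system T) {FG : Filter G} (u : T -> E) (l : E) :
  linear f -> (forall x, `|f x| <= `|x|) ->
  u @ G --> l -> f \o u @ G --> f l.
Proof.
move=> fl f1 /cvgrPdist_le ul; apply/cvgrPdist_le => e e0.
by apply: filterS (ul e e0) => t; apply: le_trans; rewrite /= -(linear_funB fl).
Qed.

(** Successive approximation, as in the proof of the open mapping theorem: the
    error left by one approximate preimage is corrected by the next one. The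
    gap between [|x|] and [r] is divided into a geometric sequence of tolerances
    that pays for all corrections. *)
Lemma approx_surj (R : realType) (E : completeNormedModType R)
    (F : normedModType R) (f : E -> F) :
  linear f -> (forall x, `|f x| <= `|x|) ->
  (forall x r d, `|x| < r -> 0 < d -> exists2 y, `|y| <= r & `|x - f y| < d) ->
  forall x r, `|x| < r -> exists2 y, `|y| <= r & f y = x.
Proof.
move=> fl f1 fa x r xr.
pose e := r - `|x|; have e0 : 0 < e by rewrite subr_gt0.
(* The first preimage spends [|x| + d 0], the n-th correction [d n], and the
   sum of all these is [|x| + 3 * d 0], which is less than [r]. *)
pose d n : R := e / 2 ^+ n.+2.
have d0 n : 0 < d n by rewrite divr_gt0// exprn_gt0.
have dS n : d n.+1 + d n.+1 = d n.
  by rewrite /d [2 ^+ n.+3]exprSr invfM mulrA -splitr.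
have /choice[next nextP] : forall p : nat * E, exists y : E,
    `|x - f p.2| < d p.1 -> `|y| <= d p.1 /\ `|x - f p.2 - f y| < d p.1.+1.
  move=> [n s] /=; have [h|] := pselect (`|x - f s| < d n); last by exists 0.
  by have [y y1 y2] := fa _ _ _ h (d0 n.+1); exists y.
have [s0 s01 s02] :=
  fa x (`|x| + d 0%N) (d 0%N) (ltr_pwDr (d0 _) (lexx _)) (d0 _).
pose s := fix s n := if n is m.+1 then s m + next (m, s m) else s0.
have sP n : `|x - f (s n)| < d n.
  elim: n => //= n IH; have [_] := nextP (n, s n) IH.
  by rewrite (linear_funD fl) opprD addrA.
have sS n : `|s n.+1 - s n| <= d n.
  by rewrite /= addrC addKr; have [] := nextP (n, s n) (sP n).
(* By [dS], the bound [d m + ... + d (m + n - 1)] telescopes. *)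
have sB m n : `|s (m + n)%N - s m| <= d m + d m - (d (m + n)%N + d (m + n)%N).
  elim: n => [|n IH]; first by rewrite addn0 !subrr normr0.
  rewrite addnS -(subrKA (s (m + n)%N)) (le_trans (ler_normD _ _))//.
  apply: le_trans (lerD (sS _) IH) _.
  by have := dS (m + n)%N; lra.
have dd : d @ \oo --> (0 : R).
  rewrite (_ : d = geometric (e / 4) (2^-1)).
    by apply: cvg_geometric; rewrite ger0_norm// invf_lt1// ltr1n.
  by apply/funext => n; rewrite /d /= !exprS mulrA -natrM invfM exprVn mulrA.
have scv : cvgn s.
  apply/cauchy_cvgP/cauchy_exP => c c0.
  have c2 : 0 < c / 2 by rewrite divr_gt0.
  have /cvgrPdist_lt/(_ _ c2)[N _ /(_ N (leqnn _))] := dd.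
  rewrite /= sub0r normrN ger0_norm ?ltW// => Nc.
  exists (s N); exists N => // n /= Nn.
  rewrite -ball_normE /= distrC -(subnKC Nn); apply: le_lt_trans (sB _ _) _.
  by have := d0 (N + (n - N))%N; lra.
exists (limn s).
  rewrite -lim_norm//; apply: limr_le; first exact: is_cvg_norm.
  apply: nearW => n; rewrite -[s n](subrK s0) (le_trans (ler_normD _ _))//.
  apply: le_trans (lerD (sB 0%N n) s01) _; rewrite add0n.
  have dn := d0 n; have d4 : d 0%N = e / 4 by rewrite /d expr2 -natrM.
  by rewrite d4; rewrite /e in dn *; lra.
have fs : f \o s @ \oo --> x.
  apply/cvgrPdist_le => c c0; move/cvgrPdist_le : dd => /(_ c c0).
  apply: filterS => n; rewrite sub0r normrN ger0_norm; last exact: ltW.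
  by move=> dc; apply: le_trans dc; exact/ltW/sP.
by rewrite -(cvg_lim _ fs)//; apply/esym/cvg_lim => //; exact: contraction_cvg.
Qed.

(** * Vector lattices and lattice homomorphisms *)

Section vector_lattice.
Context (R : realType) (V : vectorLatticeType R).
Implicit Types x y z : V.

Lemma vjoinxx x : vjoin x x = x.
Proof.
by apply: vle_anti; [apply: vjoin_le; exact: vle_refl|exact: vle_joinl].
Qed.

Lemma vleN2 x y : x <=v y -> - y <=v - x.
Proof.
by move=> /(vleD2r (- x - y)); rewrite addrA subrr add0r addrCA subrr addr0.
Qed.

Lemma vmeetE x y : vmeet x y = - vjoin (- x) (- y).
Proof.
apply: vle_anti.
  rewrite -[X in X <=v _]opprK; apply: vleN2; apply: vjoin_le; apply: vleN2.
  - exact: vmeet_lel.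
  - exact: vmeet_ler.
apply: vle_meet.
- by rewrite -[X in _ <=v X]opprK; apply: vleN2; exact: vle_joinl.
- by rewrite -[X in _ <=v X]opprK; apply: vleN2; exact: vle_joinr.
Qed.

Lemma vabs_ge0 x : 0 <=v vabs x.
Proof.
have h2 : 0 <=v vabs x + vabs x.
  rewrite -(subrr x).
  apply: (@vle_trans _ _ (vabs x - x)); first exact/vleD2r/vle_joinl.
  by rewrite [X in X <=v _]addrC; apply/vleD2r/vle_joinr.
have := @vscale_ge0 _ _ 2^-1 _ _ h2; rewrite invr_ge0 ler0n => /(_ isT).
by rewrite -mulr2n -[vabs x *+ 2]scaler_nat scalerA mulVf ?scale1r// pnatr_eq0.
Qed.

(** Both [x = y + (x - y)] and [z] lie below the right-hand side, the latter
    because [vabs (x - y)] is nonnegative. *)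
Lemma vjoin_le_vabs x y z : vjoin x z <=v vjoin y z + vabs (x - y).
Proof.
apply: vjoin_le.
  apply: (@vle_trans _ _ (y + vabs (x - y))); last exact/vleD2r/vle_joinl.
  rewrite [X in _ <=v X]addrC -[X in X <=v _](subrK y).
  exact/vleD2r/vle_joinl.
apply: (@vle_trans _ _ (z + vabs (x - y))); last exact/vleD2r/vle_joinr.
by rewrite addrC -[X in X <=v _]add0r; exact/vleD2r/vabs_ge0.
Qed.

Lemma vjoinC x y : vjoin x y = vjoin y x.
Proof.
apply: vle_anti; apply: vjoin_le;
  [exact: vle_joinr|exact: vle_joinl|exact: vle_joinr|exact: vle_joinl].
Qed.

Lemma vabsB x y : vabs (x - y) = vabs (y - x).
Proof. by rewrite /vabs !opprB vjoinC. Qed.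

Lemma vabs_vjoin x y z : vabs (vjoin x z - vjoin y z) <=v vabs (x - y).
Proof.
apply: vjoin_le.
  rewrite -[X in _ <=v X](addrK (vjoin y z)) [X in _ <=v X - _]addrC.
  exact/vleD2r/vjoin_le_vabs.
rewrite opprB -[X in _ <=v X](addrK (vjoin x z)) [X in _ <=v X - _]addrC vabsB.
exact/vleD2r/vjoin_le_vabs.
Qed.

End vector_lattice.

Lemma vabs_hom (R : realType) (V W : vectorLatticeType R) (f : V -> W) (x : V) :
  lattice_hom f -> f (vabs x) = vabs (f x).
Proof.
move=> [fl fj _]; rewrite /vabs fj; congr vjoin.
by rewrite -scaleN1r linear_funZ// scaleN1r.
Qed.

Lemma lattice_hom_le (R : realType) (V W : vectorLatticeType R) (f : V -> W)
    (x y : V) : lattice_hom f -> x <=v y -> f x <=v f y.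
Proof.
move=> [_ fj _] xy; have <- : vjoin x y = y.
  by apply: vle_anti; [apply: vjoin_le => //; exact: vle_refl|exact: vle_joinr].
by rewrite fj; exact: vle_joinl.
Qed.

(** Makes joins continuous, so that the closure of a sublattice is one. *)
Lemma norm_vjoinB (R : realType) (X : banachLatticeType R) (x x' y y' : X) :
  `|vjoin x y - vjoin x' y'| <= `|x - x'| + `|y - y'|.
Proof.
rewrite -[_ - _](subrKA (vjoin x' y)); apply: le_trans (ler_normD _ _) _.
apply: lerD; first exact/ler_norm_vabs/vabs_vjoin.
by rewrite !(vjoinC x'); exact/ler_norm_vabs/vabs_vjoin.
Qed.

Lemma closure_normP (R : realType) (V : normedModType R) (A : set V) (x : V) :
  closure A x <-> forall e, 0 < e -> exists2 a, A a & `|x - a| < e.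
Proof.
split=> [Ax e e0|Ax B].
  have /Ax[a [Aa]] : nbhs x (ball x e) by exact: nbhsx_ballx.
  by rewrite -ball_normE /= => xa; exists a.
move=> /nbhs_ballP[e /= e0 xeB]; have [a Aa xa] := Ax e e0.
by exists a; split=> //; apply: xeB; rewrite -ball_normE.
Qed.

(** * Closed sublattices as Banach lattices *)

(** Closure under meets follows, see [csl_meet]. *)
Record closedSublattice (R : realType) (X : banachLatticeType R) :=
  ClosedSublattice {
    csl_mem :> {pred X};
    csl_submod : submod_closed csl_mem;
    csl_join : forall x y, x \in csl_mem -> y \in csl_mem ->
      vjoin x y \in csl_mem;
    csl_closed : closed [set x | x \in csl_mem] }.

Section sublattice_space.
Context (R : realType) (X : banachLatticeType R) (S : closedSublattice X).

HB.instance Definition _ :=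
  GRing.isSubmodClosed.Build R X (csl_mem S) (csl_submod S).

Record sublattice := Sublattice {
  sublattice_val :> X;
  sublatticeP : sublattice_val \in csl_mem S }.

HB.instance Definition _ := [isSub for sublattice_val].
HB.instance Definition _ := [Choice of sublattice by <:].
HB.instance Definition _ := [SubChoice_isSubLmodule of sublattice by <:].

Implicit Types x y z : sublattice.

Lemma csl_meet (x y : X) :
  x \in csl_mem S -> y \in csl_mem S -> vmeet x y \in csl_mem S.
Proof. by move=> xS yS; rewrite vmeetE rpredN csl_join// rpredN. Qed.

Definition sublattice_le x y : Prop := sublattice_val x <=v sublattice_val y.
Definition sublattice_join x y : sublattice :=
  Sublattice (csl_join (sublatticeP x) (sublatticeP y)).
Definition sublattice_meet x y : sublattice :=
  Sublattice (csl_meet (sublatticeP x) (sublatticeP y)).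

Let le_refl x : sublattice_le x x. Proof. exact: vle_refl. Qed.

Let le_anti x y : sublattice_le x y -> sublattice_le y x -> x = y.
Proof. by move=> xy yx; apply/val_inj/vle_anti. Qed.

Let le_trans y x z : sublattice_le x y -> sublattice_le y z ->
  sublattice_le x z.
Proof. exact: vle_trans. Qed.

Let leD2r z x y : sublattice_le x y -> sublattice_le (x + z) (y + z).
Proof. exact: vleD2r. Qed.

Let scale_ge0 (a : R) x : 0 <= a -> sublattice_le 0 x ->
  sublattice_le 0 (a *: x).
Proof. exact: vscale_ge0. Qed.

Let le_joinl x y : sublattice_le x (sublattice_join x y).
Proof. exact: vle_joinl. Qed.

Let le_joinr x y : sublattice_le y (sublattice_join x y).
Proof. exact: vle_joinr. Qed.

Let join_le x y z : sublattice_le x z -> sublattice_le y z ->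
  sublattice_le (sublattice_join x y) z.
Proof. exact: vjoin_le. Qed.

Let meet_lel x y : sublattice_le (sublattice_meet x y) x.
Proof. exact: vmeet_lel. Qed.

Let meet_ler x y : sublattice_le (sublattice_meet x y) y.
Proof. exact: vmeet_ler. Qed.

Let le_meet x y z : sublattice_le z x -> sublattice_le z y ->
  sublattice_le z (sublattice_meet x y).
Proof. exact: vle_meet. Qed.

HB.instance Definition _ := Lmodule_isVectorLattice.Build R sublattice
  le_refl le_anti le_trans leD2r scale_ge0
  le_joinl le_joinr join_le meet_lel meet_ler le_meet.

Definition sublattice_norm x : R := `|x : X|.

Let normD x y :
  sublattice_norm (x + y) <= sublattice_norm x + sublattice_norm y.
Proof. exact: ler_normD. Qed.

Let normZ (a : R) x : sublattice_norm (a *: x) = `|a| * sublattice_norm x.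
Proof. exact: normrZ. Qed.

Let norm_eq0 x : sublattice_norm x = 0 -> x = 0.
Proof. by move=> /normr0_eq0 x0; exact: val_inj. Qed.

HB.instance Definition _ :=
  Lmodule_isNormed.Build R sublattice normD normZ norm_eq0.

(** A limit taken in [X] stays in [S] because [S] is closed. *)
Lemma sublattice_cauchy_cvg (F : set_system sublattice) :
  ProperFilter F -> cauchy F -> cvg F.
Proof.
move=> PF /cauchyP cF.
have cvF : cvg (sublattice_val @ F).
  apply: cauchy_cvg; apply: (@cauchy_exP R X) => e e0; have [x Fx] := cF _ e0.
  exists (x : X); apply: (@filterS _ F _ _ _ _ Fx) => y.
  by rewrite -!ball_normE.
have lS : lim (sublattice_val @ F) \in csl_mem S.
  apply: (closed_cvg _ (@csl_closed _ _ S) _ _ cvF).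
  by apply: nearW => x; exact: sublatticeP.
apply/cvg_ex; exists (Sublattice lS); apply/cvgrPdist_le => e e0.
by move/cvgrPdist_le : cvF => /(_ _ e0).
Qed.

HB.instance Definition _ :=
  Uniform_isComplete.Build sublattice sublattice_cauchy_cvg.

Let norm_vabs x y : vabs x <=v vabs y -> `|x| <= `|y|.
Proof. exact: (@ler_norm_vabs R X). Qed.

HB.instance Definition _ :=
  Normed_VectorLattice_isBanachLattice.Build R sublattice norm_vabs.

Lemma lattice_hom_comp_val (V : vectorLatticeType R) (f : V -> sublattice) :
  lattice_hom f -> lattice_hom (sublattice_val \o f).
Proof.
move=> [fl fj fm]; split=> [a x y|x y|x y] /=; last 2 first.
- by rewrite fj.
- by rewrite fm.
- by rewrite fl.
Qed.

(** The inclusion preserves norms, disjointness and the function calculus, so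
    that the inequalities that define [D]-convexity in [X] can be read in [S]. *)
Lemma D_convex_sublattice (D : convexity_condition R) :
  D_convex D X -> D_convex D sublattice.
Proof.
move=> DX m g Dg x x0 xd Phi [Phih Phix].
have := DX m g Dg (fun i => x i : X) x0 _ (sublattice_val \o Phi).
apply.
  move=> th i j ij; exact: (congr1 sublattice_val (xd th i j ij)).
split; first exact: lattice_hom_comp_val.
by move=> k /=; rewrite Phix.
Qed.

End sublattice_space.

(** * Unit vectors and truncations in the space of summable sequences *)

Section ell1_basis.
Context (R : realType).
Implicit Types (y : ell1 R) (n N : nat).

Lemma esum_norm_unit n :
  esum_norm (fun k => (k == n)%:R : R) = 1%E.
Proof.
rewrite /esum_norm -[RHS](@esum_set1 R nat n (fun=> 1%E))//.
rewrite [RHS]esum_mkcond; apply: eq_esum => k _.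
have -> : (k \in [set n]) = (k == n) by apply/idP/eqP; rewrite inE.
by case: (k == n); rewrite /= ?normr1 ?normr0.
Qed.

Lemma ell1_unit_subproof n : (fun k => (k == n)%:R : R) \in ell1_pred R.
Proof. by apply/ell1_predP; rewrite esum_norm_unit ltry. Qed.

Definition ell1_unit n : ell1 R := Ell1 (ell1_unit_subproof n).

Lemma norm_ell1_unit n : `|ell1_unit n| = 1.
Proof. by rewrite -[LHS]/(fine _) esum_norm_unit. Qed.

Lemma ell1_normE_nneseries y : `|y|%:E = (\sum_(0 <= k <oo) `|y k|%:E)%E.
Proof. by rewrite -[`|y|]/(ell1_norm y) ell1_normE nneseries_esumT. Qed.

Lemma ell1_norm_ge_sum y n : \sum_(0 <= k < n) `|y k| <= `|y|.
Proof.
rewrite -lee_fin ell1_normE_nneseries -sumEFin.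
by apply: nneseries_lim_ge => k _ _; rewrite lee_fin.
Qed.

Definition ell1_trunc y N : ell1 R := \sum_(0 <= k < N) y k *: ell1_unit k.

Lemma ell1_truncE y N k : ell1_trunc y N k = if (k < N)%N then y k else 0.
Proof.
rewrite /ell1_trunc; elim: N => [|N IH]; first by rewrite big_geq.
rewrite big_nat_recr//= -[LHS]/(_ k + y N * (k == N)%:R) IH.
rewrite [(k < N.+1)%N]ltnS [(k <= N)%N]leq_eqVlt.
have [->|kN] := eqVneq k N; first by rewrite ltnn mulr1 add0r.
by rewrite mulr0 addr0.
Qed.

(** The two summands have disjoint supports. *)
Lemma ell1_norm_truncB y N : `|y| = `|ell1_trunc y N| + `|y - ell1_trunc y N|.
Proof.
apply: EFin_inj; rewrite EFinD.
rewrite -![`|_|%:E]/(ell1_norm _)%:E !ell1_normE /esum_norm -esumD//.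
apply: eq_esum => k _.
rewrite -[(y - ell1_trunc y N) k]/(y k - ell1_trunc y N k) ell1_truncE.
by case: ifP => _; rewrite ?subrr ?subr0 ?abse0 ?adde0 ?add0e.
Qed.

Lemma ell1_trunc_dense y e : 0 < e -> exists N, `|y - ell1_trunc y N| < e.
Proof.
move=> e0.
have : (fun n => \sum_(0 <= k < n) `|y k|%:E)%E @ \oo --> `|y|%:E.
  rewrite ell1_normE_nneseries; apply: is_cvg_nneseries => k _ _.
  by rewrite lee_fin.
under eq_cvg do rewrite sumEFin.
move=> /fine_cvg /cvgrPdist_lt /(_ _ e0)[N _ /(_ N (leqnn N))] /= yN.
exists N; apply: le_lt_trans yN.
rewrite [`|y| in leRHS](ell1_norm_truncB y N) -[leRHS]ger0_norm//.
rewrite normr_id (le_trans _ (ler_norm _))// addrAC lerDr subr_ge0.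
apply: le_trans (ell1_norm_ge_sum _ N); rewrite [leLHS]big_nat [leRHS]big_nat.
by apply: ler_sum => k /andP[_ kN]; rewrite ell1_truncE kN.
Qed.

End ell1_basis.

(** * The operator on absolutely summable sequences with prescribed values *)

Section ell1_operator.
Context (R : realType) (X : completeNormedModType R) (x : nat -> X)
  (x1 : forall n, `|x n| <= 1).
Implicit Types y : ell1 R.

Definition ell1_op y : X := limn (series (fun k => y k *: x k)).

Lemma ell1_op_norm_sum y n : \sum_(0 <= k < n) `|y k *: x k| <= `|y|.
Proof.
apply: le_trans (ell1_norm_ge_sum y n); apply: ler_sum => k _.
by rewrite normrZ ler_piMr.
Qed.

Lemma ell1_op_cvg y : cvgn (series (fun k => y k *: x k)).
Proof.
apply: normed_cvg; apply: nondecreasing_is_cvgn.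
  by apply: nondecreasing_series => k _ _; exact: normr_ge0.
by exists `|y| => _ [n _ <-]; exact: ell1_op_norm_sum.
Qed.

Lemma ell1_op_linear : linear ell1_op.
Proof.
move=> a y z; rewrite /ell1_op -limZl_tmp; last exact: ell1_op_cvg.
rewrite -limD; [|by apply: is_cvgZl_tmp; exact: ell1_op_cvg|exact: ell1_op_cvg].
congr (limn _); apply/funext => n; rewrite /series /=.
rewrite -[RHS]/(a *: _ + _) scaler_sumr -big_split /=.
by apply: eq_bigr => k _; rewrite scalerA -scalerDl.
Qed.

Lemma ell1_op_norm y : `|ell1_op y| <= `|y|.
Proof.
rewrite -lim_norm; last exact: ell1_op_cvg.
apply: limr_le; first by apply: is_cvg_norm; exact: ell1_op_cvg.
apply: nearW => n; apply: le_trans (ell1_op_norm_sum y n).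
exact: ler_norm_sum.
Qed.

Lemma ell1_op_unit n : ell1_op (ell1_unit R n) = x n.
Proof.
apply/cvg_lim => //; apply: cvg_near_cst; exists n.+1 => // m /= nm.
rewrite /series /= (bigD1_seq n) ?mem_index_iota ?iota_uniq//= eqxx scale1r.
by rewrite big1 ?addr0// => k /negbTE ->; rewrite scale0r.
Qed.

End ell1_operator.

(** * Countably generated closed sublattices *)

Section countably_generated_sublattice.
Context (R : realType) (X : banachLatticeType R) (d : nat -> X).

(** One function covers both operations, so that a level of the construction
    below is a single image of a countable set. *)
Definition rat_span_op (o : option rat) (x y : X) : X :=
  if o is Some q then ratr q *: x + y else vjoin x y.

(** Each level contains the previous one, since [vjoin x x = x]. *)
Definition rat_span_level n : set X :=
  iter n (fun A => [set rat_span_op t.1 t.2.1 t.2.2 |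
                     t in [set: option rat] `*` (A `*` A)]) (range d).

Definition rat_span : set X := \bigcup_n rat_span_level n.

Lemma countable_rat_span : countable rat_span.
Proof.
apply: bigcup_countable => [|n _]; first exact: countableP.
elim: n => [|n IH]; apply: card_le_trans (card_image_le _ _) _.
  exact: countableP.
by do 2![apply: countableX => //]; exact: countableP.
Qed.

Lemma rat_span_level_leq m n : (m <= n)%N ->
  rat_span_level m `<=` rat_span_level n.
Proof.
elim: n => [|n IH]; first by rewrite leqn0 => /eqP ->.
rewrite leq_eqVlt => /predU1P[->//|]; rewrite ltnS => /IH mn x /mn nx.
by exists (None, (x, x)); [split|exact: vjoinxx].
Qed.

Lemma rat_span_pair x y : rat_span x -> rat_span y ->
  exists n, rat_span_level n x /\ rat_span_level n y.
Proof.
move=> [m _ mx] [n _ ny]; exists (maxn m n).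
by split; [apply: rat_span_level_leq mx|apply: rat_span_level_leq ny];
   rewrite leq_max leqnn ?orbT.
Qed.

Lemma rat_span_gen n : rat_span (d n).
Proof. by exists 0%N => //; exists n. Qed.

Lemma rat_span_lin (q : rat) x y : rat_span x -> rat_span y ->
  rat_span (ratr q *: x + y).
Proof.
move=> Ax Ay; have [n [nx ny]] := rat_span_pair Ax Ay.
by exists n.+1 => //; exists (Some q, (x, y)).
Qed.

Lemma rat_span_0 : rat_span 0.
Proof.
rewrite -(addNr (d 0)) -scaleN1r -[-1](rmorphN1 (@ratr R)).
exact: rat_span_lin (rat_span_gen 0) (rat_span_gen 0).
Qed.

Lemma rat_span_join x y : rat_span x -> rat_span y -> rat_span (vjoin x y).
Proof.
move=> Ax Ay; have [n [nx ny]] := rat_span_pair Ax Ay.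
by exists n.+1 => //; exists (None, (x, y)).
Qed.

Definition gen_sublattice_pred : {pred X} := fun x => `[< closure rat_span x >].

Lemma gen_sublattice_predP x :
  reflect (forall e : R, 0 < e -> exists2 a, rat_span a & `|x - a| < e)
          (x \in gen_sublattice_pred).
Proof. by apply: (iffP (asboolP _)) => /closure_normP. Qed.

(** Real scalars are admitted only after closing: [a *: x + y] is approximated
    by [ratr q *: u + v], with [q] near [a] chosen before [u] near [x], because
    the tolerance on [u] depends on [q]. *)
Lemma gen_sublattice_submod_closed : submod_closed gen_sublattice_pred.
Proof.
split=> [|a x y /gen_sublattice_predP Sx /gen_sublattice_predP Sy];
  apply/gen_sublattice_predP => e e0.
  by exists 0; [exact: rat_span_0|rewrite subrr normr0].
have e3 : 0 < e / 3 by rewrite divr_gt0.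
have [q aq] : exists q : rat, `|a - ratr q| * `|x| < e / 3.
  have c0 : 0 < e / 3 / (`|x| + 1) by rewrite divr_gt0// ltr_wpDl.
  have [q] : exists q : rat, ratr q \in `]a, (a + e / 3 / (`|x| + 1))[%R.
    by apply: rat_in_itvoo; rewrite ltrDl.
  rewrite in_itv /= => /andP[aq qa]; exists q.
  rewrite distrC gtr0_norm ?subr_gt0//.
  have : ratr q - a < e / 3 / (`|x| + 1) by rewrite ltrBlDl.
  rewrite ltr_pdivlMr ?ltr_wpDl// mulrDr mulr1; apply: le_lt_trans.
  by rewrite lerDl subr_ge0 ltW.
have c0 : 0 < e / 3 / (`|ratr q : R| + 1) by rewrite divr_gt0// ltr_wpDl.
have [u Au xu] := Sx _ c0; have [v Av yv] := Sy _ e3.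
exists (ratr q *: u + v); first exact: rat_span_lin.
have -> : a *: x + y - (ratr q *: u + v) =
    (a - ratr q) *: x + ratr q *: (x - u) + (y - v).
  by rewrite scalerBl scalerBr subrKA addrACA -opprD.
have xu' : `|ratr q : R| * `|x - u| < e / 3.
  move: xu; rewrite ltr_pdivlMr ?ltr_wpDl// mulrDr mulr1 mulrC.
  by apply: le_lt_trans; rewrite lerDl.
rewrite (le_lt_trans (ler_normD _ _))//.
rewrite (le_lt_trans (lerD (ler_normD _ _) (lexx _)))//.
rewrite [`|_ *: x|]normrZ [`|_ *: (x - u)|]normrZ.
by apply: lt_le_trans (ltrD (ltrD aq xu') yv) _; lra.
Qed.

Lemma gen_sublattice_join x y :
  x \in gen_sublattice_pred -> y \in gen_sublattice_pred ->
  vjoin x y \in gen_sublattice_pred.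
Proof.
move=> /gen_sublattice_predP Sx /gen_sublattice_predP Sy.
apply/gen_sublattice_predP => e e0.
have e2 : 0 < e / 2 by rewrite divr_gt0.
have [u Au xu] := Sx _ e2; have [v Av yv] := Sy _ e2.
exists (vjoin u v); first exact: rat_span_join.
by apply: le_lt_trans (norm_vjoinB _ _ _ _) _; lra.
Qed.

Lemma gen_sublattice_closed : closed [set x | x \in gen_sublattice_pred].
Proof.
rewrite (_ : [set x | _] = closure rat_span); first exact: closed_closure.
by apply/seteqP; split=> x /asboolP.
Qed.

Definition gen_sublattice : closedSublattice X :=
  ClosedSublattice gen_sublattice_submod_closed gen_sublattice_join
    gen_sublattice_closed.

Lemma gen_sublattice_gen n : d n \in csl_mem gen_sublattice.
Proof.
apply/gen_sublattice_predP => e e0.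
by exists (d n); [exact: rat_span_gen|rewrite subrr normr0].
Qed.

Lemma separable_gen : (forall x, x \in csl_mem gen_sublattice) -> separable X.
Proof.
move=> SX; exists rat_span; first exact: countable_rat_span.
move=> O [x Ox] oO; have /asboolP Sx := SX x.
by have [|a [Aa Oa]] := Sx O; [exact: open_nbhs_nbhs|exists a].
Qed.

End countably_generated_sublattice.

(** * Separability of the free space *)

Section density_in_free.
Context (R : realType) (D : convexity_condition R) (E : completeNormedModType R)
  (F : banachLatticeType R) (phi : E -> F) (freeF : is_free_D_convex D phi).

(** The extension of [phi] to a homomorphism into [S], followed by the inclusion
    of [S], is the identity of [F] by uniqueness of extensions. *)
Lemma free_sublattice_full (S : closedSublattice F) :
  (forall y, phi y \in csl_mem S) -> forall x, x \in csl_mem S.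
Proof.
move=> phiS x; have [DF phil phi1 univ] := freeF.
pose T y : sublattice S := Sublattice (phiS y).
have Tl : linear T by move=> a y z; apply: val_inj; exact: phil.
have T1 : (opnorm T <= 1)%E by apply/(opnorm_le1 Tl) => y; rewrite -phi1.
have bT : bounded_operator T by split=> //; apply: le_lt_trans T1 (ltry _).
have bphi : bounded_operator phi.
  split=> //; apply: (@le_lt_trans _ _ 1%E); last exact: ltry.
  by apply/(opnorm_le1 phil) => y; rewrite phi1.
have [U [[[Uh UT] _] _]] := univ _ (D_convex_sublattice (S := S) DF) T bT.
have [W [[_ Wuniq] _]] := univ F DF phi bphi.
have WU : W = @sublattice_val _ _ S \o U.
  apply: Wuniq; split; first exact: lattice_hom_comp_val.
  by rewrite -compA UT.
have Wid : W = id by apply: Wuniq; split.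
have -> : x = sublattice_val (U x).
  by rewrite -[LHS]/(id x) -Wid WU.
exact: sublatticeP.
Qed.

End density_in_free.

Lemma separable_free_ell1 (R : realType) (D : convexity_condition R)
    (F : banachLatticeType R) (phi : ell1 R -> F) :
  is_free_D_convex D phi -> separable F.
Proof.
move=> freeF; pose S := gen_sublattice (phi \o ell1_unit R).
apply: (@separable_gen _ _ (phi \o ell1_unit R)).
apply: (free_sublattice_full freeF) => y.
have [_ phil phi1 _] := freeF.
apply: (@csl_closed _ _ S); apply/closure_normP => e e0.
have [N yN] := ell1_trunc_dense y e0.
exists (phi (ell1_trunc y N)); last by rewrite -(linear_funB phil) phi1.
rewrite /ell1_trunc /=; elim: {yN}N => [|N IH].
  by rewrite big_geq// (linear_fun0 phil); exact: (csl_submod S).1.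
rewrite big_nat_recr//= addrC phil.
exact: (csl_submod S).2 _ _ _ (gen_sublattice_gen _ N) IH.
Qed.

(** * Quotient maps onto separable spaces *)

Section dense_unit_ball.
Context (R : realType) (X : completeNormedModType R).

Lemma separable_unit_ball : separable X ->
  exists x : nat -> X, (forall n, `|x n| <= 1) /\
    forall u e, `|u| < 1 -> 0 < e -> exists n, `|u - x n| < e.
Proof.
move=> [A cA dA]; have [f fA] := pcard_surjP cA.
(* Terms of the dense sequence outside the unit ball are replaced by [0]; those
   that approximate a point of the open ball closely enough are kept. *)
exists (fun n => if `|f n| <= 1 then f n else 0); split.
  by move=> n; case: ifP => // _; rewrite normr0.
move=> u e u1 e0; pose c := Num.min e (1 - `|u|).
have c0 : 0 < c by rewrite lt_min e0 subr_gt0.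
have [|] := dA (ball u c) _ (ball_open u c).
  by exists u; exact: ballxx c0.
move=> a [] /=; rewrite -ball_normE /= lt_min => /andP[uae ua1].
move=> /fA[n _ fna]; exists n; rewrite fna ifT// -(subrK u a).
rewrite (le_trans (ler_normD _ _))// distrC.
by rewrite -lerBrDr ltW.
Qed.

Lemma ell1_op_surj (x : nat -> X) (x1 : forall n, `|x n| <= 1) :
  (forall u e, `|u| < 1 -> 0 < e -> exists n, `|u - x n| < e) ->
  forall u r, `|u| < r -> exists2 y, `|y| <= r & ell1_op x y = u.
Proof.
move=> xd; apply: approx_surj; first exact: ell1_op_linear.
  exact: ell1_op_norm.
move=> u r e ur e0; have r0 : 0 < r by apply: le_lt_trans ur.
have [||n un] := xd (r^-1 *: u) (e / r).
- by rewrite normrZ gtr0_norm ?invr_gt0// mulrC ltr_pdivrMr// mul1r.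
- by rewrite divr_gt0.
exists (r *: ell1_unit R n).
  by rewrite normrZ norm_ell1_unit mulr1 gtr0_norm.
rewrite (linear_funZ (ell1_op_linear x1)) ell1_op_unit.
have -> : u - r *: x n = r *: (r^-1 *: u - x n).
  by rewrite scalerBr scalerA divff ?gt_eqF// scale1r.
by rewrite normrZ gtr0_norm// mulrC -ltr_pdivlMr.
Qed.

End dense_unit_ball.

(** Lifting [p z] with norm less than [e + |p z|] yields an element of the coset
    of [z] of that norm, so the quotient norm is at most [|p z|]; the converse
    inequality is contractivity. *)
Lemma quotient_by_kernel (R : realType) (Z X : banachLatticeType R)
    (p : Z -> X) :
  lattice_hom p -> (forall z, `|p z| <= `|z|) ->
  (forall x r, `|x| < r -> exists2 z, `|z| <= r & p z = x) ->
  closed_ideal (p @^-1` [set 0]) /\ is_quotient (p @^-1` [set 0]) p.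
Proof.
move=> ph p1 psurj; have pl : linear p by case: ph.
split; split=> /=.
- move=> z /closure_normP Jz; apply/normr0_eq0/eqP.
  rewrite eq_le normr_ge0 andbT; apply/ler_addgt0Pl => e e0; rewrite addr0.
  have [j /= pj0 zj] := Jz e e0.
  rewrite -[p z]subr0 -pj0 -(linear_funB pl).
  exact: le_trans (p1 _) (ltW zj).
- exact: linear_fun0.
- by move=> a x y px py; rewrite pl px py scaler0 addr0.
- move=> x y xy py; apply/normr0_eq0/eqP.
  rewrite eq_le normr_ge0 andbT -[leRHS](normr0 X) -py.
  apply: ler_norm_vabs; rewrite -!(vabs_hom _ ph).
  exact: lattice_hom_le.
- exact: ph.
- move=> x _; have [z _ <-] := psurj x (`|x| + 1) (ltr_pwDr ltr01 (lexx _)).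
  by exists z.
- by [].
- move=> z; apply/eqP; rewrite eq_le; apply/andP; split.
    apply: lb_le_inf; first by exists `|z + 0|, 0 => //=; exact: linear_fun0.
    move=> _ [j /= pj <-]; apply: le_trans (p1 _).
    by rewrite (linear_funD pl) pj addr0.
  apply/ler_addgt0Pl => e e0; have pze : `|p z| < e + `|p z| by rewrite ltrDr.
  have [y yr py] := psurj _ _ pze; apply: le_trans yr.
  apply: ge_inf; first by exists 0 => _ [j _ <-].
  exists (y - z); last by rewrite addrC subrK.
  by rewrite /= (linear_funB pl) py subrr.
Qed.

(** * Projective universality *)

Theorem theorem4p4 (R : realType) (D : convexity_condition R)
    (FBL : banachLatticeType R) (phi : ell1 R -> FBL)
    (hFBL : is_free_D_convex D phi) :
  projectively_universal D FBL.
Proof.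
have [DF _ phi1 univ] := hFBL.
split=> //; first exact: separable_free_ell1 hFBL.
move=> X sX DX; have [x [x1 xd]] := separable_unit_ball sX.
have Tl := ell1_op_linear x1; have T1 := ell1_op_norm x1.
have oT : (opnorm (ell1_op x) <= 1)%E by apply/opnorm_le1.
have [|p [[[ph pT] _] pn]] := univ X DX (ell1_op x).
  by split=> //; apply: le_lt_trans oT (ltry _).
have pl : linear p by case: ph.
have p1 : forall z, `|p z| <= `|z| by apply/opnorm_le1 => //; rewrite pn.
have [|Jid pq] := quotient_by_kernel ph p1.
  move=> u r /(ell1_op_surj x1 xd)[y yr <-].
  by exists (phi y); [rewrite phi1|rewrite -pT].
exists (p @^-1` [set 0]), X, p; split=> //.
by exists id; split=> // u _; exists u.
Qed.
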